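(* Let $X$ be an infinite set. (i) $\operatorname{rank}(\mathcal{PB}_X:\mathcal G_X^L)=1$. (ii) If $\alpha\in\mathcal{PB}_X$, then $\mathcal{PB}_X=\langle\mathcal G_X^L\cup\{\alpha\}\rangle$ if and only if $\alpha\in\mathcal G_X^R$ and $h^*(\alpha)=|X|$.
   Context: Partial Brauer monoid. Let $X$ be a set and $X'=\{x':x\in X\}$ a disjoint copy of $X$. A Brauer graph is an (undirected) graph with vertex set $X\cup X'$ in which every vertex has degree at most $1$; $\mathcal{PB}_X$ is the set of all of them. Product: let $X''=\{x'':x\in X\}$ be another disjoint copy of $X$; given $\alpha,\beta\in\mathcal{PB}_X$, let $\alpha^\vee$ be $\alpha$ with each vertex $x'$ renamed $x''$, let $\beta^\wedge$ be $\beta$ with each vertex $x\in X$ renamed $x''$, and let $\Pi(\alpha,\beta)$ be the graph on $X\cup X'\cup X''$ with all edges of $\alpha^\vee$ and $\beta^\wedge$. Then $\alpha\beta$ is the graph on $X\cup X'$ with an edge $\{x,y\}$ whenever $x,y\in X\cup X'$ are distinct and lie in the same connected component of $\Pi(\alpha,\beta)$. This makes $\mathcal{PB}_X$ a monoid with identity the graph with edge set $\{\{x,x'\}:x\in X\}$. For $\alpha\in\mathcal{PB}_X$, $h^*(\alpha)$ is the number (a cardinal) of lower hooks of $\alpha$, i.e. edges $\{x',y'\}$ with $x,y\in X$ distinct. In a monoid $M$, an element $x$ is a left unit if $ax=1$ for some $a\in M$, and a right unit if $xb=1$ for some $b\in M$. $\mathcal G_X^L$ and $\mathcal G_X^R$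 denote the submonoids of all left units and all right units of $\mathcal{PB}_X$. For a subset $U$ of a semigroup $S$, $\langle U\rangle$ is the subsemigroup generated by $U$. For $A\subseteq S$, the relative rank is $\operatorname{rank}(S:A)=\min\{|U| : U\subseteq S,\ S=\langle A\cup U\rangle\}$. *)

(* Defs.v *)
From Stdlib Require Import Relation_Operators.
From HB Require Import structures.
From mathcomp Require Import all_boot.
From mathcomp Require Import boolp classical_sets functions cardinality.

Set Implicit Arguments.
Unset Strict Implicit.
Unset Printing Implicit Defensive.

Local Open Scope classical_set_scope.
Local Open Scope card_scope.

Section Generation.
Variable S : semigroupType.

Definition mul_closed (A : set S) : Prop :=
  forall x y : S, A x -> A y -> A (x * y)%g.

Definition generated (U : set S) : set S := smallest mul_closed U.

(* [relative_rank A K] states rank(S : A) = |K|. There is no type of cardinals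
   in the library, so the cardinal on the right is represented by any set [K]
   that has this cardinality. *)
Definition relative_rank (A : set S) (T : Type) (K : set T) : Prop :=
  (exists2 U : set S, generated (A `|` U) = setT & U #= K) /\
  (forall U : set S, generated (A `|` U) = setT -> K #<= U).

End Generation.

Definition left_units (M : monoidType) : set M :=
  [set x | exists a : M, (a * x)%g = 1%g].

Definition right_units (M : monoidType) : set M :=
  [set x | exists b : M, (x * b)%g = 1%g].

Arguments left_units M : clear implicits.
Arguments right_units M : clear implicits.

(* In [X + X], [inl x] is the upper vertex x and [inr x] the lower vertex x'. *)
Record brauer (X : Type) := Brauer {
  edge :> X + X -> X + X -> Prop;
  edge_sym : forall u v, edge u v -> edge v u;
  edge_irr : forall u, ~ edge u u;
  edge_deg : forall u, is_subset1 [set v | edge u v]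
}.

(* The vertices x, x'' and x' of the product graph, respectively. *)
Inductive pvertex (X : Type) := Top of X | Mid of X | Bot of X.

Definition rename (V W : Type) (f : V -> W) (e : V -> V -> Prop) : W -> W -> Prop :=
  fun p q => exists u v, [/\ e u v, p = f u & q = f v].

Section ProductGraph.
Variable X : Type.
Implicit Types (a b : brauer X) (u v : X + X) (p q : pvertex X).

Definition vee u : pvertex X :=
  match u with inl x => Top x | inr x => Mid x end.
Definition wedge u : pvertex X :=
  match u with inl x => Mid x | inr x => Bot x end.
Definition outer u : pvertex X :=
  match u with inl x => Top x | inr x => Bot x end.

Definition product_graph a b : pvertex X -> pvertex X -> Prop :=
  fun p q => rename vee a p q \/ rename wedge b p q.

(* [clos_refl_trans] suffices for connectedness, as the graphs are symmetric. *)
Definition mul_edge a b : X + X -> X + X -> Prop :=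
  fun u v => u <> v /\ clos_refl_trans _ (product_graph a b) (outer u) (outer v).

End ProductGraph.

Section Walks.
Variable V : Type.
Implicit Types (e : V -> V -> Prop).

Lemma conn_step e p q : e p q -> clos_refl_trans _ e p q.
Proof. exact: rt_step. Qed.

Lemma conn_refl e p : clos_refl_trans _ e p p.
Proof. exact: rt_refl. Qed.

Lemma conn_trans e p q r :
  clos_refl_trans _ e p q -> clos_refl_trans _ e q r -> clos_refl_trans _ e p r.
Proof. exact: rt_trans. Qed.

Lemma conn_ind e p (Q : V -> Prop) :
  Q p -> (forall q r, clos_refl_trans _ e p q -> Q q -> e q r -> Q r) ->
  forall q, clos_refl_trans _ e p q -> Q q.
Proof.
move=> Qp Qe q pq.
have H x y : clos_refl_trans _ e x y ->
    clos_refl_trans _ e p x /\ Q x -> clos_refl_trans _ e p y /\ Q y.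
  elim=> [{}x {}y exy [px Qx]|//|{}x {}y z _ IHx _ IHy /IHx //].
  by split; [exact: conn_trans px (conn_step exy) | exact: Qe px Qx exy].
by case: (H _ _ pq (conj (conn_refl _ _) Qp)).
Qed.

Lemma conn_sym e p q : (forall x y, e x y -> e y x) ->
  clos_refl_trans _ e p q -> clos_refl_trans _ e q p.
Proof.
move=> esym; elim=> [x y exy|x|x y z _ yx _ zy]; last exact: conn_trans zy yx.
- by apply: conn_step; exact: esym.
- exact: conn_refl.
Qed.

Lemma conn_mono e e' p q :
  (forall x y, e x y -> clos_refl_trans _ e' x y) ->
  clos_refl_trans _ e p q -> clos_refl_trans _ e' p q.
Proof.
move=> ee'; elim=> [x y /ee'//|x|x y z _ xy _ yz]; last exact: conn_trans xy yz.
exact: conn_refl.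
Qed.

(* Walks without backtracking in a graph that is the union of two matchings. *)
Section Alternating.
Variable E : bool -> V -> V -> Prop.
Hypothesis Esym : forall c x y, E c x y -> E c y x.
Hypothesis Edeg : forall c x y z, E c x y -> E c x z -> y = z.
Variables (u : V) (c0 : bool).
Hypothesis Eu : forall c x, E c u x -> c = c0.

Inductive alternating : nat -> bool -> V -> Prop :=
| Alt0 : alternating 0 (~~ c0) u
| AltS n c x y : alternating n c x -> E (~~ c) x y -> alternating n.+1 (~~ c) y.

Lemma alternating_det n c x c' x' :
  alternating n c x -> alternating n c' x' -> c = c' /\ x = x'.
Proof.
move=> A; elim: A c' x' => [|{}n {}c {}x y _ IH Exy] c' x' A'; inversion A' => //.
by case: (IH _ _ H0) => ? ?; subst; split=> //; exact: Edeg Exy H1.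
Qed.

Lemma alternating_pred n c x : alternating n.+1 c x ->
  exists y, alternating n (~~ c) y /\ E c y x.
Proof. by move=> A; inversion A; subst; exists x0; rewrite negbK. Qed.

Lemma alternating_le n m c x : (n <= m)%N -> alternating m c x ->
  exists c' y, alternating n c' y.
Proof.
elim: m c x => [|m IH] c x; first by rewrite leqn0 => /eqP -> A; exists c, x.
rewrite leq_eqVlt => /orP[/eqP -> A|nm /alternating_pred[y [A _]]].
  by exists c, x.
exact: IH nm A.
Qed.

Lemma alternating_conn x :
  clos_refl_trans _ (fun p q => E true p q \/ E false p q) u x ->
  exists n c, alternating n c x.
Proof.
move: x; apply: conn_ind => [|y z _ [n [c A]] Eyz]; first by exists 0%N, (~~ c0); constructor.
have [d Ed] : exists d, E d y z by case: Eyz => ?; [exists true | exists false].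
case: (d =P ~~ c) => [dc|/eqP].
  by exists n.+1, d; subst d; exact: AltS A Ed.
have -> : (d != ~~ c) = (d == c) by case: (d) (c) => -[].
move=> /eqP dc; subst d; case: n A => [A|n /alternating_pred[w [A Ewy]]].
  by inversion A; subst; move: (Eu Ed); case: (c0).
by exists n, (~~ c); rewrite -(Edeg (Esym Ewy) Ed).
Qed.

Lemma alternating_end n m c c' x y cx : x <> u ->
  (forall d z, E d x z -> d = cx) ->
  alternating n c x -> alternating m c' y -> (m <= n)%N.
Proof.
move=> xu Ex Ax Ay; rewrite leqNgt; apply/negP => /alternating_le/(_ Ay).
move=> [d [z /alternating_pred[w [Aw Ewz]]]].
have [dc wx] := alternating_det Aw Ax; subst w.
case: n Ax Aw => [Ax|n Ax] Aw; first by case: xu; inversion Ax.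
have [t [_ Etx]] := alternating_pred Ax.
by move: (Ex _ _ Ewz) (Ex _ _ (Esym Etx)) dc => -> ->; case: (cx).
Qed.

Lemma alternating_uniq x y cx cy :
  (forall d z, E d x z -> d = cx) -> (forall d z, E d y z -> d = cy) ->
  x <> u -> y <> u ->
  clos_refl_trans _ (fun p q => E true p q \/ E false p q) u x ->
  clos_refl_trans _ (fun p q => E true p q \/ E false p q) u y -> x = y.
Proof.
move=> Ex Ey xu yu /alternating_conn[n [c Ax]] /alternating_conn[m [d Ay]].
have nm : n = m.
  apply/eqP; rewrite eqn_leq.
  by rewrite (alternating_end yu Ey Ay Ax) (alternating_end xu Ex Ax Ay).
by subst m; case: (alternating_det Ax Ay).
Qed.

End Alternating.
End Walks.

Lemma conn_rename (V W : Type) (f : V -> W) (e : V -> V -> Prop) p q :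
  injective f ->
  clos_refl_trans _ (rename f e) (f p) (f q) <-> clos_refl_trans _ e p q.
Proof.
move=> finj; split.
  have H r : clos_refl_trans _ (rename f e) (f p) r ->
      exists2 s, r = f s & clos_refl_trans _ e p s.
    move: r; apply: conn_ind => [|r t _ [s -> ps] [s' [w [sw /finj ss ->]]]]; last subst s'.
      by exists p => //; exact: conn_refl.
    by exists w => //; apply: conn_trans ps _; exact: conn_step.
  by move=> /H [s /finj ->].
elim=> [x y exy|x|x y z _ xy _ yz]; last exact: conn_trans xy yz.
- by apply: conn_step; exists x, y.
- exact: conn_refl.
Qed.

Section Multiplication.
Variable X : Type.
Implicit Types (a b c : brauer X) (u v w : X + X) (p q : pvertex X).

Lemma vee_inj : injective (@vee X). Proof. by move=> [x|x] [y|y] //= [->]. Qed.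
Lemma wedge_inj : injective (@wedge X). Proof. by move=> [x|x] [y|y] //= [->]. Qed.
Lemma outer_inj : injective (@outer X). Proof. by move=> [x|x] [y|y] //= [->]. Qed.

Lemma rename_sym (W : Type) (f : X + X -> W) a (r s : W) :
  rename f a r s -> rename f a s r.
Proof. by move=> [u [v [/edge_sym auv -> ->]]]; exists v, u. Qed.

Lemma rename_deg (W : Type) (f : X + X -> W) a (r s t : W) : injective f ->
  rename f a r s -> rename f a r t -> s = t.
Proof.
move=> finj [u [v [auv -> ->]]] [u' [w [auw /finj uu ->]]]; subst u'.
by rewrite (edge_deg auv auw).
Qed.

Lemma product_graph_sym a b p q : product_graph a b p q -> product_graph a b q p.
Proof. by case=> H; [left | right]; exact: rename_sym. Qed.

Lemma mul_sym a b u v : mul_edge a b u v -> mul_edge a b v u.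
Proof.
move=> [uv H]; split; first by move=> /esym.
exact: conn_sym (@product_graph_sym a b) H.
Qed.

Lemma mul_irr a b u : ~ mul_edge a b u u.
Proof. by case. Qed.

Lemma mul_deg a b u : is_subset1 [set v | mul_edge a b u v].
Proof.
move=> v w [/= uv cv] [uw cw]; apply: outer_inj.
pose E (c : bool) := if c then rename (@vee X) a else rename (@wedge X) b.
have Eout t : forall (d : bool) p, E d (outer t) p -> d = if t is inl _ then true else false.
  by case: t => t [] z [[s|s] [r [_ //= ]]].
apply: (@alternating_uniq _ E _ _ (outer u) _ (Eout u) _ _ _ _ (Eout v) (Eout w)) => //.
- by case=> x y; exact: rename_sym.
- by case=> x y z; apply: rename_deg; [exact: vee_inj | exact: wedge_inj].
- by move=> /outer_inj/esym.
- by move=> /outer_inj/esym.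
Qed.

Definition brauer_mul a b : brauer X :=
  Brauer (@mul_sym a b) (@mul_irr a b) (@mul_deg a b).

Definition one_edge u v : Prop :=
  exists x : X, u = inl x /\ v = inr x \/ u = inr x /\ v = inl x.

Lemma one_sym u v : one_edge u v -> one_edge v u.
Proof. by move=> [x [[-> ->]|[-> ->]]]; exists x; [right | left]. Qed.

Lemma one_irr u : ~ one_edge u u.
Proof. by move=> [x [[-> //]|[-> //]]]. Qed.

Lemma one_deg u : is_subset1 [set v | one_edge u v].
Proof.
move=> v w [x H] [y K]; case: H K => -[-> ->] [] [] // e ->; by case: e => ->.
Qed.

Definition brauer_one : brauer X := Brauer one_sym one_irr one_deg.

Lemma brauer_eq a b : (forall u v, a u v <-> b u v) -> a = b.
Proof.
case: a b => [e s i d] [e' s' i' d'] /= H.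
have ee' : e = e' by apply/funext => u; apply/funext => v; exact/propext.
by subst e'; congr Brauer; exact: Prop_irrelevance.
Qed.

Lemma conn_retract a (e : pvertex X -> pvertex X -> Prop) (h : pvertex X -> X + X) :
  (forall p q, e p q -> h p = h q \/ a (h p) (h q)) ->
  forall p q, clos_refl_trans _ e p q -> h p = h q \/ a (h p) (h q).
Proof.
move=> eh p; apply: conn_ind => [|q r _ IH /eh H]; first by left.
case: IH H => [-> //|pq [<-|qr]]; first by right.
by left; exact: edge_deg (edge_sym pq) qr.
Qed.

Lemma brauer_mul1 : left_id brauer_one brauer_mul.
Proof.
move=> a; apply: brauer_eq => u v; split=> /=.
  move=> [uv H].
  pose h p : X + X := match p with Top x | Mid x => inl x | Bot x => inr x end.
  have := @conn_retract a _ h _ _ _ H.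
  have -> : h (outer u) = u by case: (u).
  have -> : h (outer v) = v by case: (v).
  case=> // p q [[s [t [[x [[-> ->]|[-> ->]]] -> ->]]]|[s [t [ast -> ->]]]];
    by [left | right; case: s t ast => ? [?|?]].
move=> auv; split; first by move=> uv; subst v; exact: edge_irr auv.
have H w : clos_refl_trans _ (product_graph brauer_one a) (outer w) (wedge w).
  case: w => x; last exact: conn_refl.
  by apply: conn_step; left; exists (inl x), (inr x); split=> //; exists x; left.
apply: conn_trans (H u) _; apply: conn_trans (conn_sym _ (H v)).
  by apply: conn_step; right; exists u, v.
exact: product_graph_sym.
Qed.

Lemma brauer_mulr1 : right_id brauer_one brauer_mul.
Proof.
move=> a; apply: brauer_eq => u v; split=> /=.
  move=> [uv H].
  pose h p : X + X := match p with Top x => inl x | Mid x | Bot x => inr x end.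
  have := @conn_retract a _ h _ _ _ H.
  have -> : h (outer u) = u by case: (u).
  have -> : h (outer v) = v by case: (v).
  case=> // p q [[s [t [ast -> ->]]]|[s [t [[x [[-> ->]|[-> ->]]] -> ->]]]];
    by [left | right; case: s t ast => ? [?|?]].
move=> auv; split; first by move=> uv; subst v; exact: edge_irr auv.
have H w : clos_refl_trans _ (product_graph a brauer_one) (outer w) (vee w).
  case: w => x; first exact: conn_refl.
  by apply: conn_step; right; exists (inr x), (inl x); split=> //; exists x; right.
apply: conn_trans (H u) _; apply: conn_trans (conn_sym _ (H v)).
  by apply: conn_step; left; exists u, v.
exact: product_graph_sym.
Qed.

(* Eliminating the middle layer of a product graph inside a larger graph. *)
Lemma conn_contract (W : Type) (T : W -> W -> Prop) (f : pvertex X -> W) a b (p q : W) :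
  injective f -> (forall x r, ~ T (f (Mid x)) r) -> (forall x r, ~ T r (f (Mid x))) ->
  (forall x, p <> f (Mid x)) -> (forall x, q <> f (Mid x)) ->
  clos_refl_trans _
    (fun r s => T r s \/ rename (fun u => f (outer u)) (brauer_mul a b) r s) p q <->
  clos_refl_trans _ (fun r s => T r s \/ rename f (product_graph a b) r s) p q.
Proof.
move=> finj Tl Tr pH qH; split.
  apply: conn_mono => r s [Trs|[u [v [[_ H] -> ->]]]].
    by apply: conn_step; left.
  move/(conn_rename _ _ _ finj): H; apply: conn_mono => x y xy.
  by apply: conn_step; right.
set G' := (X in _ -> clos_refl_trans _ X p q).
have outerP (z : pvertex X) : (exists x, z = Mid x) \/ exists u, z = outer u.
  by case: z => x; [right; exists (inl x) | left; exists x | right; exists (inr x)].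
have link u v r : clos_refl_trans _ G' r (f (outer u)) ->
    clos_refl_trans _ (product_graph a b) (outer u) (outer v) ->
    clos_refl_trans _ G' r (f (outer v)).
  move=> ru uv; have [<- //|ne] := EM (u = v).
  by apply: conn_trans ru _; apply: conn_step; right; exists u, v.
suff H r : clos_refl_trans _ (fun r s => T r s \/ rename f (product_graph a b) r s) p r ->
    ((forall x, r <> f (Mid x)) -> clos_refl_trans _ G' p r) /\
    (forall x, r = f (Mid x) -> exists u, clos_refl_trans _ G' p (f (outer u)) /\
        clos_refl_trans _ (product_graph a b) (outer u) (Mid x)).
  by move=> /H[+ _]; exact.
move: r; apply: conn_ind => [|r s _ [IHo IHm] [Trs|[y [z [yz ry sz]]]]].
- by split=> [_|x /pH //]; exact: conn_refl.
- split=> [_|x sx]; last by subst s; case: (Tr _ _ Trs).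
  apply: conn_trans (IHo _) _; last by apply: conn_step; left.
  by move=> x rx; subst r; case: (Tl _ _ Trs).
- have [u [pu uy]] : exists u, clos_refl_trans _ G' p (f (outer u)) /\
      clos_refl_trans _ (product_graph a b) (outer u) y.
    case: (outerP y) => [[x yx]|[u yu]]; subst y; first exact: IHm.
    exists u; split; last exact: conn_refl.
    by rewrite -ry; apply: IHo => x; rewrite ry => /finj; case: (u).
  have uz : clos_refl_trans _ (product_graph a b) (outer u) z.
    by apply: conn_trans uy _; exact: conn_step.
  split=> [sN|x]; last by rewrite sz => /finj zx; subst z; exists u.
  case: (outerP z) => [[x zx]|[v zv]]; first by case: (sN x); rewrite sz zx.
  by rewrite sz zv; apply: link pu _; rewrite -zv.
Qed.

Definition layers (i j k : nat) p : nat * X :=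
  match p with Top x => (i, x) | Mid x => (j, x) | Bot x => (k, x) end.

Definition layers2 (i j : nat) u : nat * X :=
  match u with inl x => (i, x) | inr x => (j, x) end.

Lemma layers_inj i j k : i != j -> i != k -> j != k -> injective (layers i j k).
Proof.
by move=> ij ik jk [x|x|x] [y|y|y] [] // e; move: ij ik jk; rewrite e ?eqxx //= => *; congruence.
Qed.

Lemma layers_vee i j k u : layers i j k (vee u) = layers2 i j u.
Proof. by case: u. Qed.
Lemma layers_wedge i j k u : layers i j k (wedge u) = layers2 j k u.
Proof. by case: u. Qed.
Lemma layers_outer i j k u : layers i j k (outer u) = layers2 i k u.
Proof. by case: u. Qed.

Lemma rename_layers i j k a b r s :
  rename (layers i j k) (product_graph a b) r s <->
  rename (layers2 i j) a r s \/ rename (layers2 j k) b r s.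
Proof.
split.
  move=> [p [q [[[u [v [uv -> ->]]]|[u [v [uv -> ->]]]] -> ->]]].
    by left; exists u, v; rewrite !layers_vee.
  by right; exists u, v; rewrite !layers_wedge.
move=> [[u [v [uv -> ->]]]|[u [v [uv -> ->]]]].
  by exists (vee u), (vee v); rewrite !layers_vee; split=> //; left; exists u, v.
by exists (wedge u), (wedge v); rewrite !layers_wedge; split=> //; right; exists u, v.
Qed.

Lemma conn_iff (V : Type) (e e' : V -> V -> Prop) (p q : V) :
  (forall x y, e x y <-> e' x y) ->
  clos_refl_trans _ e p q <-> clos_refl_trans _ e' p q.
Proof. by move=> H; split; apply: conn_mono => x y /H xy; exact: conn_step. Qed.

Definition product_graph3 a b c (r s : nat * X) : Prop :=
  [\/ rename (layers2 0 1) a r s, rename (layers2 1 2) b r s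
    | rename (layers2 2 3) c r s].

Lemma mul_mulr a b c u v :
  brauer_mul a (brauer_mul b c) u v <->
  u <> v /\ clos_refl_trans _ (product_graph3 a b c) (layers2 0 3 u) (layers2 0 3 v).
Proof.
suff H : clos_refl_trans _ (product_graph a (brauer_mul b c)) (outer u) (outer v) <->
    clos_refl_trans _ (product_graph3 a b c) (layers2 0 3 u) (layers2 0 3 v).
  by split=> -[uv /H].
rewrite -(@conn_rename _ _ (layers 0 1 3)); last exact: layers_inj.
rewrite !layers_outer; transitivity (clos_refl_trans _ (fun r s =>
    rename (layers2 0 1) a r s \/
    rename (fun u => layers 1 2 3 (outer u)) (brauer_mul b c) r s)
    (layers2 0 3 u) (layers2 0 3 v)).
  apply: conn_iff => x y; rewrite rename_layers.
  suff -> : (fun u => layers 1 2 3 (outer u)) = layers2 1 3 by [].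
  by apply/funext => w; exact: layers_outer.
rewrite conn_contract.
- apply: conn_iff => x y; rewrite rename_layers; split.
    by move=> [?|[?|?]]; [constructor 1 | constructor 2 | constructor 3].
  by move=> [?|?|?]; [left | right; left | right; right].
- exact: layers_inj.
- by move=> x r [[?|?] [? [_ //]]].
- by move=> x r [? [[?|?] [_ _ //]]].
- by case: (u).
- by case: (v).
Qed.

Lemma mul_mull a b c u v :
  brauer_mul (brauer_mul a b) c u v <->
  u <> v /\ clos_refl_trans _ (product_graph3 a b c) (layers2 0 3 u) (layers2 0 3 v).
Proof.
suff H : clos_refl_trans _ (product_graph (brauer_mul a b) c) (outer u) (outer v) <->
    clos_refl_trans _ (product_graph3 a b c) (layers2 0 3 u) (layers2 0 3 v).
  by split=> -[uv /H].
rewrite -(@conn_rename _ _ (layers 0 2 3)); last exact: layers_inj.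
rewrite !layers_outer; transitivity (clos_refl_trans _ (fun r s =>
    rename (layers2 2 3) c r s \/
    rename (fun u => layers 0 1 2 (outer u)) (brauer_mul a b) r s)
    (layers2 0 3 u) (layers2 0 3 v)).
  apply: conn_iff => x y; rewrite rename_layers.
  suff -> : (fun u => layers 0 1 2 (outer u)) = layers2 0 2 by rewrite orC.
  by apply/funext => w; exact: layers_outer.
rewrite conn_contract.
- apply: conn_iff => x y; rewrite rename_layers; split.
    by move=> [?|[?|?]]; [constructor 3 | constructor 1 | constructor 2].
  by move=> [?|?|?]; [right; left | right; right | left].
- exact: layers_inj.
- by move=> x r [[?|?] [? [_ //]]].
- by move=> x r [? [[?|?] [_ _ //]]].
- by case: (u).
- by case: (v).
Qed.

Lemma brauer_mulA : associative brauer_mul.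
Proof. by move=> a b c; apply: brauer_eq => u v; rewrite mul_mulr mul_mull. Qed.

End Multiplication.

HB.instance Definition _ (X : Type) := gen_eqMixin (brauer X).
HB.instance Definition _ (X : Type) := gen_choiceMixin (brauer X).
HB.instance Definition _ (X : Type) :=
  isSemigroup.Build (brauer X) (@brauer_mulA X).
HB.instance Definition _ (X : Type) :=
  Semigroup_isMonoid.Build (brauer X) (@brauer_mul1 X) (@brauer_mulr1 X).

(* Each lower hook is an unordered pair, so it is counted once. *)
Definition lower_hooks (X : Type) (a : brauer X) : set (set (X + X)) :=
  [set h | exists x y : X, [/\ x <> y, a (inr x) (inr y) & h = [set inr x; inr y]]].

(* Main.v *)
From Stdlib Require Import Relation_Operators.
Require Import Defs.
From mathcomp Require Import all_boot.
From mathcomp Require Import boolp classical_sets functions cardinality.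

(** A Brauer graph that is a left unit has all its lower vertices on
    transversals, and dually for right units.

    Let [a] be a right unit with [|X|] lower hooks. The transversals of [a]
    carry each upper vertex [x] down to some [g x], and the hooks provide
    disjoint pairs [k y, h y] of lower vertices, one for each [y] in [X]. Given
    an arbitrary graph [b], a left unit [router b] is put below [a]. It sends
    [k y] down to the lower vertex [y], so that [y] is connected through the
    hook to [h y]. Every vertex of [b], upper or lower, thus has a private
    representative in the middle layer, namely [g x] or [h y], and [router b]
    draws the edges of [b] between these representatives. Therefore
    [a * router b = b] ([mul_router]), and [a] generates everything together
    with the left units ([right_unit_hooks_generate]). Turning a router upside
    down yields such an [a] ([exists_right_unit_hooks]).

    Conversely, let [a] generate everything together with the left units, and
    let [r] be a right unit with [|X|] lower hooks, which cannot be a left unit.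
    Write [r] as a word. A prefix of left units in a word that is a right unit
    consists of units and can be cancelled, so some occurrence of [a] starts a
    right unit, and [a] is one ([right_unit_generator]). For the hooks, a walk
    in the product graph of [x] and [y] that joins two lower vertices
    must run through a lower hook of [x] or be a lower hook of [y]. Distinct
    hooks of the product lie in distinct components, hence the [|X|] hooks of a
    product split into those that charge a hook of [x] and those that charge
    a hook of [y]. As [X] is infinite, one of the two parts has [|X|] elements
    ([infinite_cover2]), so one of the factors has [|X|] lower hooks
    ([many_lower_hooks_mul]). Left units have no lower hook, so the hooks of [r]
    must come from [a]. The cardinal arithmetic rests on the existence of maximal
    disjoint families of sets, a form of Zorn's lemma. *)

Set Implicit Arguments.
Unset Strict Implicit.
Unset Printing Implicit Defensive.

Local Open Scope classical_set_scope.
Local Open Scope card_scope.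

(** * Splitting an infinite cardinal into two *)

Lemma card_le_inj (T U : Type) (B : set U) :
  [set: T] #<= B -> exists2 f : T -> U, injective f & forall t, B (f t).
Proof.
move=> /card_leP[f].
exists (fun t => set_val (f (SigSub (mem_set (I : [set: T] t))))).
  move=> s t /val_inj /(inj (f := f)); rewrite !in_setT.
  by move=> /(_ isT isT) -[].
by move=> t; apply: set_valP.
Qed.

Lemma inj_card_leT (T U : Type) (B : set U) (f : T -> U) :
  injective f -> (forall t, B (f t)) -> [set: T] #<= B.
Proof.
move=> finj fB; have := @inj_card_eq _ _ setT f (in2W finj).
rewrite card_eq_sym => /card_eqPle[le _]; apply: card_le_trans le _.
by apply: subset_card_le => _ [t _ <-].
Qed.

(** Comparability of cardinals: a disjoint family of pairs [{inl a, inr b}] is a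
    partial bijection, and a maximal one exhausts [A] or [B]. *)
Lemma inj_total (A B : Type) :
  (exists f : A -> B, injective f) \/ (exists f : B -> A, injective f).
Proof.
pose F (p : A * B) : set (A + B) := [set inl p.1; inr p.2].
have [E [_ Edisj Emax]] := ex_maximal_disjoint_subcollection F setT.
have EP p q z : E p -> E q -> F p z -> F q z -> p = q.
  by move=> Ep Eq pz qz; apply: (Edisj _ _ Ep Eq); exists z.
have [Ea|/existsNP[a Na]] := EM (forall a, exists b, E (a, b)).
  left; have [f Ef] := choice Ea; exists f => a a' ff.
  have [//] : (a, f a) = (a', f a').
  by apply: (EP _ _ (inr (f a))) => //; right; rewrite //= ff.
have [Eb|/existsNP[b Nb]] := EM (forall b, exists a, E (a, b)).
  right; have [f Ef] := choice Eb; exists f => b b' ff.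
  have [//] : (f b, b) = (f b', b').
  by apply: (EP _ _ (inl (f b))) => //; left; rewrite //= ff.
exfalso; apply: (Emax (E `|` [set (a, b)])) => //.
  split=> [|EE]; first exact: subsetUl.
  by apply: Na; exists b; apply: EE; right.
have Nab p z : E p -> F p z -> F (a, b) z -> False.
  case: p => a' b' Ep [] -> [] // [e].
    by apply: Na; exists b'; rewrite -e.
  by apply: Nb; exists a'; rewrite -e.
move=> p q [Ep|->] [Eq|->] // [z [pz qz]].
- exact: EP Ep Eq pz qz.
- by case: (Nab _ _ Ep pz qz).
- by case: (Nab _ _ Eq qz pz).
Qed.

(** [2 * |T| = |T|]: up to a finite remainder, a maximal disjoint family of
    injective sequences partitions [T] into countably infinite blocks, and each
    block absorbs two copies of itself. *)
Lemma infinite_double (T : Type) : infinite_set [set: T] ->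
  exists f : bool * T -> T, injective f.
Proof.
move=> Tinf.
have [E [ED Edisj Emax]] :=
  ex_maximal_disjoint_subcollection (fun f : nat -> T => range f) [set f | injective f].
pose R := ~` \bigcup_(f in E) range f.
have Rfin : finite_set R.
  apply: contrapT => /infiniteP/card_le_inj[f finj fR].
  have Nf g n m : E g -> g n <> f m.
    by move=> Eg gf; apply: (fR m); exists g => //; exists n.
  apply: (Emax (E `|` [set f])).
  - split=> [|EE]; first exact: subsetUl.
    by apply: (Nf f 0 0) => //; apply: EE; right.
  - by move=> g [/ED|->].
  - move=> g g' [Eg|->] [Eg'|->] // [_ [[n _ <-] [m _ e]]].
    + by apply: (Edisj _ _ Eg Eg'); exists (g n); split; [exists n | exists m].
    + by case: (Nf _ _ _ Eg (esym e)).
    + by case: (Nf _ _ _ Eg' e).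
(* The finite remainder [R] is merged into the block of one sequence [f0]. Then
   [c x] is the sequence that enumerates the block of [x], up to [R], and [u]
   numbers each block. *)
have [f0 Ef0] : E !=set0.
  apply: contrapT => /nonemptyPn E0; apply: Tinf; move: Rfin.
  by rewrite /R E0 bigcup_set0 setC0.
have /choice[c cP] : forall x, exists f, E f /\ (range f x \/ R x).
  move=> x; have [[f Ef fx]|Nx] := EM ((\bigcup_(f in E) range f) x).
    by exists f; split=> //; left.
  by exists f0; split=> //; right.
have /choice[u uinj] f : exists u : T -> nat, {in [set x | c x = f] &, injective u}.
  apply/countable_injP; apply: (@sub_countable _ _ _ (range f `|` R)).
    by apply: subset_card_le => x /= <-; case: (cP x).
  rewrite -bigcup2E; apply: bigcup_countable => // -[|[|n]] _ //=.
  - by apply: (sub_countable (card_image_le f setT)); exact: countableP.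
  - exact: finite_set_countable.
exists (fun p => c p.2 (pickle (p.1, u (c p.2) p.2))) => -[b x] [b' x'] /= e.
have [[Ex _] [Ex' _]] := (cP x, cP x').
have cc : c x = c x'.
  apply: Edisj => //; exists (c x (pickle (b, u (c x) x))).
  by split; [eexists | rewrite e; eexists].
move: e; rewrite -cc => /(ED _ Ex)/(pcan_inj pickleK)[-> e].
by congr pair; apply: uinj e; rewrite inE /=.
Qed.

(** By comparability one part, say [A], is no larger than the other, which then has
    at least half of the elements, and halving changes no infinite cardinal. *)
Lemma infinite_cover2 (T : Type) (A B : set T) : infinite_set [set: T] ->
  A `|` B = setT -> [set: T] #<= A \/ [set: T] #<= B.
Proof.
move=> Tinf.
wlog [i iinj] : A B / exists i : A -> B, injective i.
  move=> H AB; have [AleB|BleA] := inj_total A B; first exact: H.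
  by rewrite orC; apply: H => //; rewrite setUC.
move=> AB; right.
have Binf : infinite_set [set: B].
  rewrite (eq_finite_set (card_setT B)) => Bfin; apply: Tinf; rewrite -AB.
  rewrite finite_setU; split=> //.
  apply: card_le_finite Bfin; rewrite -(card_le_eql (card_setT A)).
  apply: (@inj_card_leT _ _ _ (fun x => set_val (i x))).
    by move=> x y /val_inj/iinj.
  by move=> x; exact: set_valP.
have [d dinj] := infinite_double Binf.
have /choice[k kP] x : exists p : bool * B,
    (p.1 /\ exists2 a : A, val a = x & p.2 = i a) \/ (~~ p.1 /\ val p.2 = x).
  have : (A `|` B) x by rewrite AB.
  move=> [Ax|Bx].
    exists (true, i (SigSub (mem_set Ax))); left; split=> //.
    by exists (SigSub (mem_set Ax)).
  by exists (false, SigSub (mem_set Bx)); right.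
apply: (@inj_card_leT _ _ _ (fun x => set_val (d (k x)))); last first.
  by move=> x; exact: set_valP.
move=> x y /val_inj/dinj kk; move: (kP x) (kP y); rewrite kk.
move=> [[k1 [a <- ->]]|[k1 ex]] [[k2 [b <-]]|[k2 ey]].
- by move=> /iinj ->.
- by rewrite k1 in k2.
- by rewrite k2 in k1.
- by rewrite -ex ey.
Qed.

(** * Generation and one-sided units *)

Section Generation.
Variable S : semigroupType.

Lemma generated_ind (U V : set S) : U `<=` V -> mul_closed V ->
  generated U `<=` V.
Proof. by move=> UV Vc x; apply. Qed.

Lemma sub_generated (U : set S) : U `<=` generated U.
Proof. exact: sub_smallest. Qed.

Lemma generated_mul (U : set S) : mul_closed (generated U).
Proof. by move=> x y Ux Uy V VP; apply: VP.1; [exact: Ux | exact: Uy]. Qed.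

End Generation.

Section Units.
Variable M : monoidType.
Implicit Types x y a : M.

Lemma left_unitsM : mul_closed (left_units M).
Proof.
move=> x y [a ax] [b bY]; exists (b * a)%g.
by rewrite mulgA -(mulgA b) ax mulg1.
Qed.

Lemma right_units_mull x y : right_units M (x * y)%g -> right_units M x.
Proof. by move=> [b xyb]; exists (y * b)%g; rewrite mulgA. Qed.

(** If [a * x = 1] and [x * y * b = 1], then the one-sided inverses [a] and [y * b]
    of [x] coincide, whence [y * (b * x) = a * x = 1]. *)
Lemma right_units_cancel x y :
  left_units M x -> right_units M (x * y)%g -> right_units M y.
Proof.
move=> [a ax] [b xyb]; exists (b * x)%g.
have -> : (y * (b * x) = a * (x * y * b) * x)%g by rewrite !mulgA ax mul1g.
by rewrite xyb mulg1.
Qed.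

(** By induction on [w]: when the right unit [w] is a product [x * y], [x] is a
    right unit, and if it is also a left unit it can be cancelled to make [y] a
    right unit. *)
Lemma right_unit_generator a w :
  generated (left_units M `|` [set a]) w ->
  right_units M w -> ~ left_units M w -> right_units M a.
Proof.
move=> gen wR wNL.
suff [] : right_units M w -> left_units M w \/ right_units M a by [].
move: w gen {wR wNL}; apply: generated_ind => [w [wL _|-> aR]|x y IHx IHy xyR].
- by left.
- by right.
have [xL|] := IHx (right_units_mull xyR); last by right.
have [yL|] := IHy (right_units_cancel xL xyR); last by right.
by left; exact: left_unitsM.
Qed.

End Units.

(** * Computing products of Brauer graphs *)

Section Graphs.
Context {X : Type}.
Implicit Types (a b c : brauer X) (u v w : X + X) (x y z : X).

Notation conn a b := (clos_refl_trans _ (product_graph a b)).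

Lemma edge_eq a u v w : a u v -> a u w -> v = w.
Proof. exact: edge_deg. Qed.

Lemma conn_vee a b u v : a u v -> conn a b (vee u) (vee v).
Proof. by move=> auv; apply: conn_step; left; exists u, v. Qed.

Lemma conn_wedge a b u v : b u v -> conn a b (wedge u) (wedge v).
Proof. by move=> buv; apply: conn_step; right; exists u, v. Qed.

Lemma connC a b p q : conn a b p q -> conn a b q p.
Proof. exact/conn_sym/product_graph_sym. Qed.

Lemma conn_closed a b (S : set (pvertex X)) p q :
  (forall u v, a u v -> S (vee u) -> S (vee v)) ->
  (forall u v, b u v -> S (wedge u) -> S (wedge v)) ->
  S p -> conn a b p q -> S q.
Proof.
move=> Sa Sb Sp; move: q; apply: conn_ind => // q r _ Sq [] [u [v [uv qu ->]]].
  by apply: Sa uv _; rewrite -qu.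
by apply: Sb uv _; rewrite -qu.
Qed.

(** [L p u] says that the vertex [p] of the product graph belongs to the component
    that ought to contain the outer vertex [u]. If the edges of [a] and [b]
    respect these labels up to the edges of [c], then a walk cannot
    leave the two labels of an edge of [c], because [c] has degree at most 1. *)
Lemma brauer_mul_eq a b c (L : pvertex X -> X + X -> Prop) :
  (forall u v, L (outer u) v <-> u = v) ->
  (forall u v s, a u v -> L (vee u) s -> exists2 t, L (vee v) t & s = t \/ c s t) ->
  (forall u v s, b u v -> L (wedge u) s -> exists2 t, L (wedge v) t & s = t \/ c s t) ->
  (forall u v, c u v -> conn a b (outer u) (outer v)) ->
  (a * b)%g = c.
Proof.
move=> Lo La Lb cab; apply: brauer_eq => u v; split; last first.
  move=> cuv; split; last exact: cab.
  by move=> uv; rewrite uv in cuv; exact: edge_irr cuv.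
move=> [uv cuv]; pose S := [set p | exists2 t, L p t & u = t \/ c u t].
have cS s t : (u = s \/ c u s) -> (s = t \/ c s t) -> u = t \/ c u t.
  move=> [<- //|us] [<-|st]; first by right.
  by left; apply: edge_eq (edge_sym us) st.
suff [t /Lo <- [//|//]] : S (outer v).
apply: conn_closed cuv.
- move=> s t st [r Lr us]; have [r' Lr' rr] := La _ _ _ st Lr.
  by exists r' => //; exact: cS rr.
- move=> s t st [r Lr us]; have [r' Lr' rr] := Lb _ _ _ st Lr.
  by exists r' => //; exact: cS rr.
- by exists u; [exact/Lo | left].
Qed.

(** Otherwise the component of [x] in the product graph consists of [x] and at most
    one other upper vertex, and does not reach the lower vertex [x']. *)
Lemma right_unitP a x : right_units (brauer X) a -> exists y, a (inl x) (inr y).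
Proof.
move=> [b ab]; apply: contrapT => /forallNP Na.
have : (a * b)%g (inl x) (inr x) by rewrite ab; exists x; left.
pose S : set (pvertex X) :=
  [set p | p = Top x \/ exists2 z, a (inl x) (inl z) & p = Top z].
move=> [_ xx]; suff : S (Bot x) by move=> [//|[]//].
apply: conn_closed xx.
- move=> [y|y] v yv [//|[z xz //]].
    by move=> [yx]; subst y; case: v yv => [z|z] yv; [right; exists z | case: (Na z)].
  move=> [yz]; subst z; left; rewrite (edge_eq yv (edge_sym xz)) //.
- by move=> [y|y] v _ [//|[]//].
- by left.
Qed.

Lemma left_unitP a y : left_units (brauer X) a -> exists x, a (inl x) (inr y).
Proof.
move=> [b ba]; apply: contrapT => /forallNP Na.
have : (b * a)%g (inr y) (inl y) by rewrite ba; exists y; right.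
pose S : set (pvertex X) :=
  [set p | p = Bot y \/ exists2 z, a (inr y) (inr z) & p = Bot z].
move=> [_ yy]; suff : S (Top y) by move=> [//|[]//].
apply: conn_closed yy.
- by move=> [x|x] v _ [//|[]//].
- move=> [x|x] v xv [//|[z yz //]].
    move=> [xy]; subst x; case: v xv => [z|z] xv; last by right; exists z.
    by case: (Na z); exact: edge_sym.
  move=> [xz]; subst z; left; rewrite (edge_eq xv (edge_sym yz)) //.
- by left.
Qed.

(** * Flipping and routing *)

Definition swap u : X + X := match u with inl x => inr x | inr x => inl x end.

Lemma flip_deg a u : is_subset1 [set v | a (swap u) (swap v)].
Proof. by move=> v w /= uv /(edge_eq uv); case: v w {uv} => ? [] ? // [->]. Qed.

Definition flip a : brauer X :=
  @Brauer X (fun u v => a (swap u) (swap v))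
    (fun u v => @edge_sym X a (swap u) (swap v))
    (fun u => @edge_irr X a (swap u)) (@flip_deg a).

(** A lower vertex goes up along its transversal in [a] and on along the mirror
    image of that transversal; upper hooks of [a] are glued to their own mirror
    images, in components that lie inside the middle layer. *)
Lemma flip_mul a : (forall y, exists x, a (inl x) (inr y)) -> (flip a * a)%g = 1%g.
Proof.
move=> a_full.
pose L (p : pvertex X) u := match p with
  | Top x => inl x = u | Bot x => inr x = u
  | Mid z => exists2 x, a (inl z) (inr x) & u = inl x end.
apply: (@brauer_mul_eq _ _ _ L).
- by move=> [x|x] v.
- move=> [x|z] v s uv.
    move=> <-; have [z zx] := a_full x.
    have := edge_eq (edge_sym zx) uv; case: v uv => // z' _ [<-].
    by exists (inl x); [exists x | left].
  move=> [x zx ->]; have := edge_eq zx uv; case: v uv => // x' _ [<-].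
  by exists (inl x); [| left].
- move=> [z|x] v s uv.
    move=> [x zx ->]; rewrite -(edge_eq zx uv).
    by exists (inr x) => //; right; exists x; left.
  move=> <-; have [z zx] := a_full x; rewrite -(edge_eq (edge_sym zx) uv).
  by exists (inl x); [exists x | right; exists x; right].
- suff H x : conn (flip a) a (Top x) (Bot x).
    by move=> _ _ [x [[-> ->]|[-> ->]]]; [exact: H | exact/connC/H].
  have [z zx] := a_full x; apply: (@conn_trans _ _ _ (Mid z)).
    by apply: (@conn_vee _ _ (inl x) (inr z)); exact: edge_sym.
  exact: conn_wedge zx.
Qed.

(** The left unit that is put below [a] to turn the product into [b]: [phi u] is the
    representative in the middle layer of the vertex [u] of [b], and [k y] is the
    middle vertex that is sent down to [y]. *)
Section Router.
Variables (phi : X + X -> X) (k : X -> X) (b : brauer X).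
Hypotheses (phi_inj : injective phi) (k_inj : injective k).
Hypothesis phi_k : forall u y, phi u <> k y.

Definition router_edge s t : Prop :=
  [\/ exists u v, [/\ b u v, s = inl (phi u) & t = inl (phi v)],
      exists2 y, s = inl (k y) & t = inr y
    | exists2 y, s = inr y & t = inl (k y)].

Lemma router_sym s t : router_edge s t -> router_edge t s.
Proof.
case=> [[u [v [/edge_sym vu -> ->]]]|[y -> ->]|[y -> ->]].
- by constructor 1; exists v, u.
- by constructor 3; exists y.
- by constructor 2; exists y.
Qed.

Lemma router_irr s : ~ router_edge s s.
Proof.
case=> [[u [v [uv ->]]]|[y -> //]|[y -> //]] [/phi_inj e].
by rewrite e in uv; exact: edge_irr uv.
Qed.

Lemma router_deg s : is_subset1 [set t | router_edge s t].
Proof.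
move=> t t' /= [[u [v [uv -> ->]]]|[y -> ->]|[y -> ->]]
  [[u' [v' [uv' + ->]]]|[y' + ->]|[y' + ->]] //.
- by move=> [/phi_inj uu]; rewrite -uu in uv'; rewrite (edge_eq uv uv').
- by move=> [/phi_k].
- by move=> [/esym/phi_k].
- by move=> [/k_inj ->].
- by move=> [->].
Qed.

Definition router : brauer X := Brauer router_sym router_irr router_deg.

Lemma router_full y : router (inl (k y)) (inr y).
Proof. by constructor 2; exists y. Qed.

(** An upper vertex reaches its representative through a transversal of [a], and a
    lower vertex [y] reaches it by going up to [k y] and along a hook of [a]. *)
Lemma mul_router a : (forall x, a (inl x) (inr (phi (inl x)))) ->
  (forall y, a (inr (k y)) (inr (phi (inr y)))) -> (a * router)%g = b.
Proof.
move=> a_top a_hook.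
pose L (p : pvertex X) u := match p with
  | Top x => inl x = u | Bot x => inr x = u
  | Mid z => phi u = z \/ exists2 y, u = inr y & z = k y end.
apply: (@brauer_mul_eq _ _ _ L).
- by move=> [x|x] v.
- move=> [x|z] v s uv.
    by move=> <-; rewrite -(edge_eq (a_top x) uv); exists (inl x); left.
  move=> [sz|[y -> zk]]; subst z.
    case: s uv => [x|y] uv; [rewrite -(edge_eq (edge_sym (a_top x)) uv)|
                             rewrite -(edge_eq (edge_sym (a_hook y)) uv)].
      by exists (inl x) => //; left.
    by exists (inr y); [right; exists y | left].
  by rewrite -(edge_eq (a_hook y) uv); exists (inr y); left.
- move=> u v s [[u' [v' [uv -> ->]]]|[y -> ->]|[y -> ->]] /=.
  + move=> [/phi_inj ->|[y _ /phi_k //]].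
    by exists v'; [left | right].
  + by move=> [/phi_k //|[y' -> /k_inj ->]]; exists (inr y') => //; left.
  + by move=> <-; exists (inr y); [right; exists y | left].
- have H u : conn a router (outer u) (Mid (phi u)).
    case: u => [x|y]; first exact: conn_vee (a_top x).
    apply: (@conn_trans _ _ _ (Mid (k y))).
      exact: connC (conn_wedge _ (router_full y)).
    exact: conn_vee (a_hook y).
  move=> u v uv; apply: conn_trans (H u) _; apply: conn_trans (connC (H v)).
  by apply: (@conn_wedge _ _ (inl (phi u)) (inl (phi v))); constructor 1; exists u, v.
Qed.

End Router.

(** * Counting lower hooks *)

Lemma card_lower_hooks_le a : lower_hooks a #<= [set: X].
Proof.
apply: card_le_trans (card_image_le (fun x => [set v | v = inr x \/ a (inr x) v]) setT).
apply: subset_card_le => _ [x [y [xy axy ->]]]; exists x => //=.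
apply/seteqP; split=> v /= [->|]; try by left.
- by move=> /(edge_eq axy) <-; right.
- by move=> ->; right.
Qed.

(** The hooks form a matching, so choosing an orientation of each hook produces two
    injections with disjoint images. *)
Lemma many_lower_hooksP a : [set: X] #<= lower_hooks a <->
  exists h k : X -> X, [/\ injective h, injective k, forall x y, h x <> k y
    & forall x, a (inr (k x)) (inr (h x))].
Proof.
split=> [/card_le_inj[f finj fh]|[h [k [hinj _ hk ahk]]]].
  have /choice[k /choice[h khP]] := fh.
  have kinj : injective k.
    move=> x y e; apply: finj; have [_ ax ->] := khP x; have [_ ay ->] := khP y.
    by rewrite e in ax *; have [->] := edge_eq ax ay.
  have hinj : injective h.
    move=> x y e; apply: kinj; have [_ ax _] := khP x; have [_ ay _] := khP y.
    by rewrite e in ax; have [] := edge_eq (edge_sym ax) (edge_sym ay).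
  exists h, k; split=> // [x y e|x]; last by have [] := khP x.
  have xy : x = y.
    apply: finj; have [_ ax ->] := khP x; have [_ ay ->] := khP y.
    by rewrite e in ax *; have [->] := edge_eq (edge_sym ax) ay; rewrite setUC.
  by subst y; have [+ _ _] := khP x; rewrite e.
apply: (@inj_card_leT _ _ _ (fun x => [set inr (k x); inr (h x)])).
  move=> x y e; have : [set inr (k x); inr (h x)] (inr (h y) : X + X).
    by rewrite e; right.
  by case=> -[] // => [/hk//|/hinj].
by move=> x; exists (k x), (h x); split=> // /esym/hk.
Qed.

(** Starting from [y], a walk that uses neither a lower hook of [b] nor one of [a]
    can only go up along a transversal of [b] and then along one of [a], where it
    ends at an upper vertex. *)
Lemma lower_hook_mul a b y z : (a * b)%g (inr y) (inr z) ->
  (exists x x', a (inr x) (inr x') /\ conn a b (Bot y) (Mid x)) \/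
  (exists x x', b (inr x) (inr x') /\ conn a b (Bot y) (Bot x)).
Proof.
move=> [yz yzc]; apply: contrapT => /not_orP[Na Nb].
pose S : set (pvertex X) := [set p | conn a b (Bot y) p /\ match p with
  | Bot w => w = y | Mid k => b (inr y) (inl k)
  | Top t => exists2 k, b (inr y) (inl k) & a (inl t) (inr k) end].
have : S (Bot z).
  apply: conn_closed yzc.
  - move=> u v uv [yu uS]; split; first exact: conn_trans yu (conn_vee _ uv).
    case: u uv yu uS => [t|k] uv yu.
      by move=> [k yk tk]; rewrite -(edge_eq tk uv).
    case: v uv => [t|k'] uv yk /=; first by exists k => //; exact: edge_sym.
    by case: Na; exists k, k'.
  - move=> u v uv [yu uS]; split; first exact: conn_trans yu (conn_wedge _ uv).
    case: u uv yu uS => [k|w] uv yu /=.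
      by move=> yk; rewrite -(edge_eq (edge_sym yk) uv).
    move=> e; subst w; case: v uv => [k //|w] uv; case: Nb.
    by exists y, w.
  - by split=> //; exact: conn_refl.
by move=> [_ /= e]; case: yz; rewrite e.
Qed.

(** The walk along a hook of the product meets a hook of a factor, and different
    hooks of the product lie in different components. *)
Lemma many_lower_hooks_mul a b : infinite_set [set: X] ->
  [set: X] #<= lower_hooks (a * b)%g ->
  [set: X] #<= lower_hooks a \/ [set: X] #<= lower_hooks b.
Proof.
move=> Xinf /many_lower_hooksP[h [k [_ kinj hk khP]]].
(* The vertex [k x] stands for the component of the hook indexed by [x]. *)
have sep x y : conn a b (Bot (k x)) (Bot (k y)) -> x = y.
  move=> xy; apply: contrapT => nxy.
  have kxy : (a * b)%g (inr (k x)) (inr (k y)) by split=> // -[/kinj].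
  by have [/hk] := edge_eq (khP x) kxy.
pose meets (c : brauer X) (f : X -> pvertex X) :=
  [set x | exists y z, c (inr y) (inr z) /\ conn a b (Bot (k x)) (f y)].
have key c f :
    (forall y z, c (inr y) (inr z) -> conn a b (f y) (f z)) ->
    [set: X] #<= meets c f -> [set: X] #<= lower_hooks c.
  move=> cf /card_le_inj[j jinj /choice[p /choice[q pqP]]].
  apply: (@inj_card_leT _ _ _ (fun x => [set inr (p x); inr (q x)])) => [x y e|x].
    apply/jinj/sep; have [_ xp] := pqP x; have [pq yp] := pqP y.
    apply: conn_trans xp (connC _); apply: conn_trans yp _.
    have : [set inr (p y); inr (q y)] (inr (p x) : X + X) by rewrite -e; left.
    by move=> [|] [->]; [exact: conn_refl | exact: cf].
  exists (p x), (q x); split=> //; last by have [] := pqP x.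
  by move=> e; have [] := pqP x; rewrite e => /edge_irr.
have cover : meets a (@Mid X) `|` meets b (@Bot X) = setT.
  by apply/seteqP; split=> // x _; exact: lower_hook_mul (khP x).
have [aX|bX] := infinite_cover2 Xinf cover.
- by left; apply: key aX => y z; exact: conn_vee.
- by right; apply: key bX => y z; exact: conn_wedge.
Qed.

Lemma left_unit_no_lower_hook a : left_units (brauer X) a -> lower_hooks a = set0.
Proof.
move=> aL; apply/seteqP; split=> // s [x [y [_ axy _]]].
by have [z az] := left_unitP x aL; have := edge_eq (edge_sym az) axy.
Qed.

Lemma lower_hooks_generator a (w : brauer X) : infinite_set [set: X] ->
  generated (left_units (brauer X) `|` [set a]) w ->
  [set: X] #<= lower_hooks w -> [set: X] #<= lower_hooks a.
Proof.
move=> Xinf; move: w; apply: generated_ind => [w [wL|-> //]|x y IHx IHy].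
  rewrite /= (left_unit_no_lower_hook wL) card_le0 => /eqP X0.
  by case: Xinf; rewrite X0; exact: finite_set0.
by move=> /(many_lower_hooks_mul Xinf)[].
Qed.

(** * Generating the monoid *)

Lemma right_unit_hooks_generate a :
  right_units (brauer X) a -> [set: X] #<= lower_hooks a ->
  generated (left_units (brauer X) `|` [set a]) = setT.
Proof.
move=> aR /many_lower_hooksP[h [k [hinj kinj hk khP]]].
have /choice[g ag] := fun x => right_unitP x aR.
pose phi u := match u with inl x => g x | inr y => h y end.
have gN x y z : a (inr y) (inr z) -> g x = y -> False.
  by move=> yz e; have := ag x; rewrite e => /edge_sym/(edge_eq yz).
have phi_inj : injective phi.
  move=> [x|y] [x'|y'] /= e.
  - by congr inl; have := edge_sym (ag x); rewrite e => /(edge_eq (edge_sym (ag x')))[].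
  - by case: (gN _ _ _ (edge_sym (khP y')) e).
  - by case: (gN _ _ _ (edge_sym (khP y)) (esym e)).
  - by rewrite (hinj _ _ e).
have phi_k u y : phi u <> k y.
  by case: u => [x|x]; [exact: gN (khP y) | exact: hk].
apply/seteqP; split=> // b _.
rewrite -(@mul_router _ _ b phi_inj kinj phi_k a ag khP).
apply: generated_mul; apply: sub_generated; [by right | left].
exists (flip (router b phi_inj kinj phi_k)); apply: flip_mul => y.
by exists (k y); exact: router_full.
Qed.

(** The flip of a router whose upper edges carry the identity graph: its
    [|X|] upper hooks become lower hooks. *)
Lemma exists_right_unit_hooks : infinite_set [set: X] ->
  exists2 a, right_units (brauer X) a & [set: X] #<= lower_hooks a.
Proof.
move=> /infinite_double[d dinj].
pose phi u := match u with
  | inl x => d (false, d (true, x)) | inr x => d (false, d (false, x)) end.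
pose k x := d (true, x).
have phi_inj : injective phi by move=> [x|x] [y|y] /dinj[/dinj[]] // ->.
have k_inj : injective k by move=> x y /dinj[].
have phi_k u y : phi u <> k y by case: u => x /dinj.
pose r := router 1%g phi_inj k_inj phi_k.
exists (flip r).
  by exists r; apply: flip_mul => y; exists (k y); exact: router_full.
apply/many_lower_hooksP; exists (fun x => phi (inl x)), (fun x => phi (inr x)); split.
- by move=> x y /phi_inj[].
- by move=> x y /phi_inj[].
- by move=> x y /phi_inj.
- by move=> x; constructor 1; exists (inr x), (inl x); split=> //; exists x; right.
Qed.

End Graphs.

Unset Implicit Arguments.

Theorem theorem4p9 (X : Type) (X_infinite : infinite_set [set: X]) :
  relative_rank (left_units (brauer X)) `I_1 /\
  (forall a : brauer X,
     generated (left_units (brauer X) `|` [set a]) = [set: brauer X] <->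
     right_units (brauer X) a /\ lower_hooks a #= [set: X]).
Proof.
have [r rR rX] := exists_right_unit_hooks X_infinite.
have rNL : ~ left_units (brauer X) r.
  move=> /left_unit_no_lower_hook r0; move: rX; rewrite r0 card_le0 => /eqP X0.
  by case: X_infinite; rewrite X0; exact: finite_set0.
split; last first.
  move=> a; split=> [gen|[aR /card_eqPle[_ aX]]]; last exact: right_unit_hooks_generate.
  have genr : generated (left_units (brauer X) `|` [set a]) r by rewrite gen.
  split; first exact: right_unit_generator genr rR rNL.
  by rewrite card_eq_le card_lower_hooks_le (lower_hooks_generator X_infinite genr rX).
split; first by exists [set r]; [exact: right_unit_hooks_generate | exact: card_set1].
move=> U gen; have [u Uu] : U !=set0.
  apply: contrapT => /nonemptyPn U0; apply: rNL.
  have : generated (left_units (brauer X) `|` U) r by rewrite gen.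
  rewrite U0 setU0; apply: generated_ind => //; exact: left_unitsM.
rewrite -(card_le_eql (@card_set1 _ u)); apply: subset_card_le => _ -> //.
Qed.
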